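(* Let $\Phi$ be a species of connected graphs containing the one-vertex graph, and let $\Phi_{\ge2}=\Phi-X$ be the species of $\Phi$-graphs on at least two vertices. Suppose $\Phi$ is closed under creating and deleting endpoints and $\Phi_{\ge2}$ is closed under creating and deleting duplicate vertices. Let $\Phi_{\mathcal{P}}$ be the species of point-determining $\Phi$-graphs and $\Phi_{\mathcal{M}}$ the species of $\Phi$-graphs without endpoints. Then $$\widetilde{\Phi_{\mathcal{P}}}(x)=\widetilde{\Phi_{\mathcal{M}}}(x)+x^2 .$$
   Context: Graphs are finite, simple, undirected; the empty graph is not connected. A species of graphs $\Phi$ assigns to each finite set $U$ a set of graphs with vertex set $U$, preserved under relabeling; its members are $\Phi$-graphs. $X$ is the singleton species. Two distinct vertices are duplicates if they have the same neighborhood; a graph is point-determining if it has no duplicates. $\Psi$ is closed under creating and deleting duplicate vertices if for every graph $G$ and distinct duplicate vertices $v,w$, $G$ is a $\Psi$-graph iff $G-v$ is. An endpoint is a vertex of degree $1$; $\Phi$ is closed under creating and deleting endpoints if for every graph $G$ and endpoint $v$, $G$ is a $\Phi$-graph iff $G-v$ is. For a species $\mathcal{F}$, its type generating series is $\widetilde{\mathcal{F}}(x)=\sum_{n\ge0}\tilde f_n x^n$, where $\tilde f_n$ is the number of isomorphism classes (orbits under relabeling) of $\mathcal{F}$-structures on $\{1,\dots,n\}$, i.e. the number of unlabeled structures of size $n$. *)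

(* Defs.v *)
From HB Require Import structures.
From mathcomp Require Import all_boot all_fingroup.

Set Implicit Arguments.
Unset Strict Implicit.
Unset Printing Implicit Defensive.

Section Graph.

Variable U : finType.

(* An undirected edge {x, y} is stored as the two ordered pairs (x, y) and
   (y, x); two graphs on U are Leibniz-equal iff they have the same edges. *)
Definition simple_edges (E : {set U * U}) : bool :=
  [forall x, (x, x) \notin E] &&
  [forall x, forall y, ((x, y) \in E) == ((y, x) \in E)].

Record graph := Graph { edges : {set U * U}; _ : simple_edges edges }.

HB.instance Definition _ := [isSub for edges].
HB.instance Definition _ := [Finite of graph by <:].

Variable G : graph.

Definition adj : rel U := [rel x y | (x, y) \in edges G].

Definition neighborhood (v : U) : {set U} := [set w | adj v w].

Definition duplicates (v w : U) : bool :=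
  (v != w) && (neighborhood v == neighborhood w).

Definition endpoint (v : U) : bool := #|neighborhood v| == 1.

Definition connected : bool :=
  (0 < #|U|) && [forall x, forall y, connect adj x y].

Definition point_determining : bool :=
  [forall v, forall w, ~~ duplicates v w].

Definition endpoint_free : bool := [forall v, ~~ endpoint v].

End Graph.

Section DeleteVertex.

Variables (U : finType) (G : graph U) (v : U).

Definition del_edges : {set {x : U | x != v} * {x : U | x != v}} :=
  [set p | adj G (val p.1) (val p.2)].

Lemma del_edges_simple : simple_edges del_edges.
Proof.
have /andP[/forallP irrG /forallP symG] := valP G.
apply/andP; split; apply/forallP => x; first by rewrite inE; exact: irrG.
by apply/forallP => y; rewrite !inE; exact: (forallP (symG (val x))).
Qed.

Definition del_vertex : graph {x : U | x != v} := Graph del_edges_simple.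

End DeleteVertex.

(* H is the graph obtained from G by renaming each vertex x to f x; only used
   for bijective f, in which case H is determined by G and f. *)
Definition is_relabeling (U V : finType) (f : U -> V)
    (G : graph U) (H : graph V) : bool :=
  [forall x, forall y, adj H (f x) (f y) == adj G x y].

Definition isomorphic (U : finType) : rel (graph U) :=
  [rel G H | [exists s : {perm U}, is_relabeling s G H]].

Definition relabeling_invariant (P : forall U : finType, pred (graph U)) :=
  forall (U V : finType) (f : U -> V) (G : graph U) (H : graph V),
    bijective f -> is_relabeling f G H -> P U G = P V H.

Record graph_species := GraphSpecies {
  structures :> forall U : finType, {set graph U};
  structuresP : relabeling_invariant (fun U G => G \in structures U)
}.

Section SubSpecies.

Variables (F : graph_species) (P : forall U : finType, pred (graph U)).
Hypothesis invP : relabeling_invariant P.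

Lemma sub_species_subproof :
  relabeling_invariant (fun U G => G \in [set G in F U | P G]).
Proof.
move=> U V f G H bijf relf; rewrite !inE (invP bijf relf).
by rewrite (structuresP F bijf relf).
Qed.

Definition sub_species : graph_species :=
  @GraphSpecies (fun U => [set G in F U | P G]) sub_species_subproof.

End SubSpecies.

Lemma neighborhood_relabel (U V : finType) (f : U -> V) (G : graph U)
    (H : graph V) (v : U) :
  bijective f -> is_relabeling f G H ->
  neighborhood H (f v) = f @: neighborhood G v.
Proof.
move=> bijf /forallP relf; case: (bijf) => g fK gK.
apply/setP => y; rewrite -[y]gK (mem_imset _ _ (bij_inj bijf)) !inE.
exact/eqP/(forallP (relf v)).
Qed.

Lemma forall_bij (U V : finType) (f : U -> V) (p : pred U) (q : pred V) :
  bijective f -> (forall x, q (f x) = p x) ->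
  [forall x, p x] = [forall y, q y].
Proof.
case=> g fK gK pq; apply/forallP/forallP => h x.
  by rewrite -[x]gK pq.
by rewrite -pq.
Qed.

Lemma card_ge2_invariant : relabeling_invariant (fun U _ => 1 < #|U|).
Proof. by move=> U V f G H /bij_eq_card ->. Qed.

Lemma point_determining_invariant : relabeling_invariant point_determining.
Proof.
move=> U V f G H bijf relf; apply: (forall_bij bijf) => v.
apply/esym/(forall_bij bijf) => w; rewrite /duplicates.
rewrite !(neighborhood_relabel _ bijf relf) (inj_eq (bij_inj bijf)).
by rewrite (inj_eq (imset_inj (bij_inj bijf))).
Qed.

Lemma endpoint_free_invariant : relabeling_invariant endpoint_free.
Proof.
move=> U V f G H bijf relf; apply: (forall_bij bijf) => v.
rewrite /endpoint (neighborhood_relabel _ bijf relf).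
by rewrite card_imset //; exact: bij_inj.
Qed.

Definition species_ge2 (F : graph_species) : graph_species :=
  sub_species F card_ge2_invariant.

Definition species_point_determining (F : graph_species) : graph_species :=
  sub_species F point_determining_invariant.

Definition species_endpoint_free (F : graph_species) : graph_species :=
  sub_species F endpoint_free_invariant.

Definition species_of_connected_graphs (F : graph_species) : Prop :=
  forall (U : finType) (G : graph U), G \in F U -> connected G.

(* On a one-element vertex set there is exactly one graph. *)
Definition contains_one_vertex_graph (F : graph_species) : Prop :=
  forall (U : finType) (G : graph U), #|U| = 1 -> G \in F U.

Definition closed_under_duplicates (F : graph_species) : Prop :=
  forall (U : finType) (G : graph U) (v w : U),
    duplicates G v w -> G \in F U <-> del_vertex G v \in F {x : U | x != v}.

Definition closed_under_endpoints (F : graph_species) : Prop :=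
  forall (U : finType) (G : graph U) (v : U),
    endpoint G v -> G \in F U <-> del_vertex G v \in F {x : U | x != v}.

(* Formal power series with natural coefficients, as coefficient sequences;
   they are compared coefficientwise, with =1. *)
Definition fps := nat -> nat.

Definition fps_add (a b : fps) : fps := fun n => a n + b n.

Definition fps_Xn (k : nat) : fps := fun n => (n == k).

Definition type_series (F : graph_species) : fps :=
  fun n => #|equivalence_partition (@isomorphic 'I_n) (F 'I_n)|.

(* Main.v *)
Require Import Defs.
From mathcomp Require Import all_boot.
From mathcomp Require Import all_fingroup all_order all_algebra zify.

(** Both series equal the plethystic substitution of x - x^2 in the cycle index
    of Phi, up to terms of degree at most 2: each vertex either stays as it is, or
    is replaced by two vertices, with a sign. The two vertices are either a vertex
    and an endpoint attached to it, or a vertex and a duplicate of it.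

    On a fixed vertex set U with at least 3 elements, such a replacement is encoded
    by an idempotent map f : U -> U that is injective on its set S of moved points:
    x in S is the endpoint attached to f x, respectively a duplicate of f x. Turning
    the endpoints into duplicates is a bijection between the Phi-graphs compatible
    with f in the two senses, and it preserves the automorphisms commuting with f.
    Summing the sign (-1)^|S| * sgn(s|S) over these automorphisms s and over f, and
    exchanging sums, one gets by sign cancellation the number of automorphisms of
    each endpoint-free graph in the first case and of each point-determining graph
    in the second, every other graph contributing 0. The Cauchy-Frobenius lemma then
    gives the coefficients of the two series. *)

Set Implicit Arguments.
Unset Strict Implicit.
Unset Printing Implicit Defensive.

Import GRing.Theory.
Local Open Scope ring_scope.

(** * Signs of a permutation on its stable sets *)

Section Sign.
Variable U : finType.
Implicit Types (s t : {perm U}) (S O : {set U}).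

(** For an [s]-stable [S] this is (-1)^c, where c is the number of orbits of [s] on [S]. *)
Definition orbit_sign s S : int := (-1) ^+ (#|S| + restr_perm S s)%N.

Lemma astabs_permP s S :
  reflect (forall x, (s x \in S) = (x \in S)) (s \in 'N(S | 'P)%g).
Proof. by apply: (iffP astabsP) => h x; apply: h. Qed.

Lemma porbit_stable s x : s \in 'N(porbit s x | 'P)%g.
Proof.
apply/astabs_permP => y; rewrite -!eq_porbit_mem.
by rewrite (porbit_perm s 1 y).
Qed.

Lemma restr_perm_in s S x : s \in 'N(S | 'P)%g -> x \in S -> restr_perm S s x = s x.
Proof. exact: restr_permE. Qed.

Lemma restr_perm_out s S x : x \notin S -> restr_perm S s x = x.
Proof. by move=> xS; rewrite (out_perm (restr_perm_on S s)). Qed.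

(** Parity is defined by counting cycles: the restriction has the orbit as one cycle and fixes every
    point outside. *)
Lemma odd_restr_porbit s x :
  odd_perm (restr_perm (porbit s x) s) = ~~ odd #|porbit s x|.
Proof.
set O := porbit s x; set r := restr_perm O s.
have sO : s \in 'N(O | 'P)%g by exact: porbit_stable.
have rE i y : y \in O -> ((r ^+ i) y = (s ^+ i) y)%g.
  move=> yO; elim: i => [|i IH]; first by rewrite !expg0.
  rewrite !expgSr !permM IH restr_perm_in //.
  elim: (i) => [|j IHj]; first by rewrite expg0 perm1.
  by rewrite expgSr permM (astabs_permP _ _ sO).
have pO y : y \in O -> porbit r y = O.
  move=> yO; have -> : O = porbit s y.
    by apply/eqP; rewrite eq_porbit_mem porbit_sym.
  apply/setP => z; apply/porbitP/porbitP => -[i ->]; exists i; rewrite rE //.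
have pN y : y \notin O -> porbit r y = [set y].
  move=> yO; apply/setP => z; rewrite inE; apply/porbitP/eqP => [[i ->]|->].
    by elim: i => [|i IH]; rewrite ?expg0 ?perm1 // expgSr permM IH restr_perm_out.
  by exists 0%N; rewrite expg0 perm1.
have xO : x \in O by rewrite /O porbit_id.
have E : porbits r = O |: [set [set y] | y in ~: O].
  apply/setP => B; rewrite !inE; apply/imsetP/orP.
    move=> [y _ ->]; have [yO|yO] := boolP (y \in O); first by left; rewrite pO.
    by right; rewrite pN //; apply/imsetP; exists y; rewrite // inE.
  case=> [/eqP->|/imsetP[y]]; first by exists x; rewrite // pO.
  by rewrite inE => yO ->; exists y; rewrite // pN.
rewrite /odd_perm E cardsU1 card_imset; last exact: set1_inj.
have -> : O \notin [set [set y] | y in ~: O].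
  apply/imsetP => -[y]; rewrite inE => yO OE.
  by move: yO; rewrite OE set11.
have := cardsC O; rewrite -[RHS]/(#|U|) => <-.
by rewrite add1n oddS oddD; case: (odd _); case: (odd _).
Qed.

Lemma stableU s S O : s \in 'N(S | 'P)%g -> s \in 'N(O | 'P)%g ->
  s \in 'N(S :|: O | 'P)%g.
Proof.
by move=> /astabs_permP hS /astabs_permP hO; apply/astabs_permP => x;
  rewrite !inE hS hO.
Qed.

Lemma stableD s S O : s \in 'N(S | 'P)%g -> s \in 'N(O | 'P)%g ->
  s \in 'N(S :\: O | 'P)%g.
Proof.
by move=> /astabs_permP hS /astabs_permP hO; apply/astabs_permP => x;
  rewrite !inE hS hO.
Qed.

(** The restriction to the union is the product of the two restrictions, and the new orbit O adds
    |O| plus the parity of an |O|-cycle, an odd number in all. *)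
Lemma orbit_signU s S x : s \in 'N(S | 'P)%g -> x \notin S ->
  orbit_sign s (S :|: porbit s x) = - orbit_sign s S.
Proof.
move=> sS xS; set O := porbit s x.
have sO := porbit_stable s x; have dis y : y \in O -> y \notin S.
  case/porbitP => i ->; elim: i => [|i IH]; first by rewrite expg0 perm1.
  by rewrite expgSr permM (astabs_permP _ _ sS).
have sSO := stableU sS sO.
have E : restr_perm (S :|: O) s = (restr_perm S s * restr_perm O s)%g.
  apply/permP => y; rewrite permM; have [yS|yS] := boolP (y \in S).
    have ySO : y \in S :|: O by rewrite inE yS.
    rewrite (restr_perm_in sS yS) (restr_perm_in sSO ySO) restr_perm_out //.
    by apply/negP => /dis; rewrite (astabs_permP _ _ sS) yS.
  rewrite (restr_perm_out _ yS); have [yO|yO] := boolP (y \in O).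
    have ySO : y \in S :|: O by rewrite inE yO orbT.
    by rewrite (restr_perm_in sO yO) (restr_perm_in sSO ySO).
  by rewrite !restr_perm_out // inE negb_or yS.
rewrite /orbit_sign E -[RHS]mulN1r -exprS -signr_odd -[RHS]signr_odd;
  congr (_ ^+ nat_of_bool _).
rewrite cardsU (_ : S :&: O = set0) ?cards0 ?subn0; last first.
  by apply/setP => y; rewrite !inE; apply/andP => -[yS /dis]; rewrite yS.
rewrite /= !oddD odd_permM !oddb odd_restr_porbit -/O.
by case: (odd #|S|); case: (odd #|O|); case: (odd_perm _).
Qed.

Lemma orbit_sign0 s : orbit_sign s set0 = 1.
Proof.
rewrite /orbit_sign cards0 add0n (_ : restr_perm set0 s = 1%g) ?odd_perm1 //.
by apply/permP => x; rewrite restr_perm_out ?inE ?perm1.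
Qed.

Lemma orbit_signM s t S : s \in 'N(S | 'P)%g -> t \in 'N(S | 'P)%g ->
  orbit_sign (s * t)%g S = (-1) ^+ odd_perm (restr_perm S s) * orbit_sign t S.
Proof.
move=> sS tS; rewrite /orbit_sign morphM // -exprD -signr_odd -[RHS]signr_odd.
congr (_ ^+ nat_of_bool _); rewrite !oddD odd_permM !oddb.
by case: (odd _); case: (odd_perm _); case: (odd_perm _).
Qed.

(* Adding the s-orbit of a point of S to a stable set, or removing it, is a
   sign-reversing involution. *)
Lemma sum_orbit_sign s S : s \in 'N(S | 'P)%g ->
  \sum_(A : {set U} | (A \subset S) &&
    (s \in 'N(A | 'P)%g)) orbit_sign s A = (S == set0)%:R.
Proof.
move=> sS; have [->|[x xS]] := set_0Vmem S.
  rewrite eqxx (big_pred1 set0) ?orbit_sign0 // => A /=; rewrite subset0 andbC.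
  by have [->|//] := eqVneq A set0; rewrite ?andbF ?andbT //;
     apply/astabs_permP => x; rewrite !inE.
have -> : S == set0 = false by apply/negP => /eqP S0; rewrite S0 inE in xS.
set O := porbit s x; have sO := porbit_stable s x.
have xO : x \in O by rewrite /O porbit_id.
have OS : O \subset S.
  apply/subsetP => y /porbitP[i ->]; elim: i => [|i IH];
    first by rewrite expg0 perm1.
  by rewrite expgSr permM (astabs_permP _ _ sS).
have memO A y : s \in 'N(A | 'P)%g -> y \in O -> (y \in A) = (x \in A).
  move=> sA /porbitP[i ->]; elim: i => [|i IH]; first by rewrite expg0 perm1.
  by rewrite expgSr permM (astabs_permP _ _ sA).
rewrite (bigID (fun A : {set U} => x \in A)) /=.
rewrite (reindex_onto (fun A => A :|: O) (fun A => A :\: O)) /=; last first.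
  move=> A /andP[/andP[_ sA] xA]; apply/setP => y; rewrite !inE.
  by have [yO|yO] := boolP (y \in O); rewrite ?orbF // (memO A) // xA.
have -> : \sum_(A : {set U} | (A \subset S) && (s \in 'N(A | 'P)%g) &&
  (x \notin A)) orbit_sign s A =
   - \sum_(A : {set U} | (A \subset S) && (s \in 'N(A | 'P)%g) && (x \notin A))
       orbit_sign s (A :|: O).
  rewrite -sumrN; apply: eq_bigr => A /andP[/andP[_ sA] xA].
  by rewrite orbit_signU // opprK.
apply/eqP; rewrite subr_eq0; apply/eqP/eq_bigl => A; rewrite in_setU xO orbT andbT.
apply/idP/idP => [/andP[/andP[AS sA] /eqP AO]|/andP[/andP[AS sA] xA]].
  have xA : x \notin A by rewrite -AO !inE xO.
  rewrite xA andbT (subset_trans _ AS) ?subsetUl //=.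
  by rewrite -AO; apply: stableD.
rewrite subUset AS OS stableU //=; apply/eqP/setP => y; rewrite !inE.
by have [yO|yO] := boolP (y \in O); rewrite ?orbF // (memO A) // (negPf xA).
Qed.
End Sign.

(** * Pairings, signed counts of automorphisms, and endpoints *)

Section Functions.
Variable U : finType.
Implicit Types (f g : {ffun U -> U}) (s t : {perm U}) (A S : {set U}) (G : graph U).

Definition moved f : {set U} := [set x | f x != x].
Definition commutes s f : bool := [forall x, s (f x) == f (s x)].
Definition subfun f g : bool := [forall x, (f x == x) || (f x == g x)].
(* The moved points of f are paired with distinct fixed points of f. *)
Definition pairing f : bool :=
  [forall x, f (f x) == f x] &&
  [forall x, forall y, [&& f x != x, f y != y & f x == f y] ==> (x == y)].

Lemma mem_moved f x : (x \in moved f) = (f x != x).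
Proof. by rewrite in_set. Qed.

Lemma commutesP s f : reflect (forall x, s (f x) = f (s x)) (commutes s f).
Proof. by apply: (iffP forallP) => h x; apply/eqP/h. Qed.

Lemma subfunP f g : reflect (forall x, f x != x -> f x = g x) (subfun f g).
Proof.
apply: (iffP forallP) => h x; first by move=> fx; have /orP[|/eqP//] := h x;
  rewrite (negPf fx).
by have [//|/h ->] := eqVneq (f x) x; rewrite eqxx.
Qed.

Lemma pairingP f :
  reflect ((forall x, f (f x) = f x) /\
           (forall x y, f x != x -> f y != y -> f x = f y -> x = y)) (pairing f).
Proof.
apply: (iffP andP) => -[h1 h2]; split.
- by move=> x; apply/eqP/(forallP h1).
- move=> x y fx fy fxy; apply/eqP; move/forallP/(_ x)/forallP/(_ y)/implyP: h2;
  apply.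
  by rewrite fx fy fxy eqxx.
- by apply/forallP => x; rewrite h1.
by apply/forallP => x; apply/forallP => y; apply/implyP => /and3P[fx fy /eqP];
  move/h2 => ->.
Qed.

Lemma commutes_stable s f : commutes s f -> s \in 'N(moved f | 'P)%g.
Proof.
move/commutesP => h; apply/astabs_permP => x; rewrite !in_set -h.
by rewrite (inj_eq perm_inj).
Qed.

(** A restriction [f] of [g] is determined by its moved points, an arbitrary subset of [moved g];
    commuting with [s] means that this subset is [s]-stable. This reduces the sum to
    [sum_orbit_sign]. *)
Lemma sum_orbit_sign_subfun s g : commutes s g ->
  \sum_(f | subfun f g &&
    commutes s f) orbit_sign s (moved f) = (moved g == set0)%:R.
Proof.
move=> sg; rewrite -(sum_orbit_sign (commutes_stable sg)).
pose h A : {ffun U -> U} := [ffun x => if x \in A then g x else x].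
have hA A : A \subset moved g -> moved (h A) = A.
  move=> /subsetP Ag; apply/setP => x; rewrite in_set ffunE.
  by case: ifP => [/Ag|]; rewrite ?in_set // eqxx.
rewrite (reindex_onto h moved) => [|f /andP[/subfunP fg _]]; last first.
  apply/ffunP => x; rewrite ffunE in_set; case: ifP => [/fg->//|/negbT].
  by rewrite negbK => /eqP.
apply: eq_big => [A|A /andP[_ /eqP->]//].
apply/idP/idP => [/andP[/andP[Ag sA] /eqP AE]|/andP[Ag sA]].
  rewrite -{2}AE commutes_stable // andbT; apply/subsetP => x.
  rewrite -{1}AE in_set => hx; have/subfunP/(_ x hx) := Ag.
  by rewrite in_set => <-.
rewrite hA // eqxx andbT; apply/andP; split.
  by apply/subfunP => x; rewrite ffunE; case: ifP; rewrite ?eqxx.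
apply/commutesP => x; rewrite !ffunE (astabs_permP _ _ sA).
by case: ifP => // _; apply/commutesP.
Qed.

Lemma odd_restr_tperm t S a b :
  t \in 'N(S | 'P)%g -> a \in S -> b \in S -> a != b ->
  {in S, t =1 tperm a b} -> odd_perm (restr_perm S t).
Proof.
move=> tS aS bS ab tE; rewrite (_ : restr_perm S t = tperm a b) ?odd_tperm //.
apply/permP => x; have [xS|xS] := boolP (x \in S).
  by rewrite restr_perm_in // tE.
rewrite restr_perm_out // tpermD //; apply: contraNneq xS => <- //.
Qed.

Lemma adj_sym G x y : adj G x y = adj G y x.
Proof. by have /andP[_ /forallP/(_ x)/forallP/(_ y)/eqP] := valP G. Qed.

Lemma adj_irr G x : adj G x x = false.
Proof. by have /andP[/forallP/(_ x)/negPf] := valP G. Qed.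

Definition aut G s : bool := is_relabeling s G G.

Lemma autP G s : reflect (forall x y, adj G (s x) (s y) = adj G x y) (aut G s).
Proof.
apply: (iffP forallP) => h x; first by move=> y; apply/eqP/(forallP (h x)).
by apply/forallP => y; rewrite h.
Qed.

Lemma autM G s t : aut G t -> aut G (t * s)%g = aut G s.
Proof.
move/autP => ht; apply/autP/autP => h x y; last by rewrite !permM h ht.
have := h ((t^-1)%g x) ((t^-1)%g y); rewrite !permM !permKV => ->.
by rewrite -[in RHS](permKV t x) -[in RHS](permKV t y) ht.
Qed.

Lemma commutesM s t f : commutes t f -> commutes (t * s)%g f = commutes s f.
Proof.
move/commutesP => ht; apply/commutesP/commutesP => h x; last by rewrite !permM ht h.
by have := h ((t^-1)%g x); rewrite !permM ht !permKV.
Qed.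

(** Nothing is assumed on [adj G a b], so this serves two endpoints joined to each other as well as
    two endpoints with a common neighbor. *)
Lemma twins_aut G a b :
  (forall x, x != a -> x != b -> adj G a x = adj G b x) -> aut G (tperm a b).
Proof.
move=> h; apply/autP => x y.
case: tpermP => [->|->|/eqP xa /eqP xb]; case: tpermP => [->|->|/eqP ya /eqP yb] //;
  first [exact: adj_sym | by rewrite ?adj_irr | by rewrite ?(adj_sym G x) h].
Qed.

Definition weight G f :
  int := \sum_(s | aut G s && commutes s f) orbit_sign s (moved f).

(* Multiplication by t is a sign-reversing involution. *)
Lemma weight_odd G f t : aut G t -> commutes t f ->
  odd_perm (restr_perm (moved f) t) -> weight G f = 0.
Proof.
move=> at_ tf odd_t; suff : weight G f = - weight G f by lia.
rewrite {1}/weight (reindex_inj (mulgI t)) /= -sumrN.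
apply: eq_big => [s|s]; rewrite autM // commutesM // => /andP[_ sf].
by rewrite orbit_signM ?commutes_stable // odd_t mulN1r.
Qed.

Lemma weight_id G f : moved f = set0 -> weight G f = #|[set s | aut G s]|%:R.
Proof.
move=> f0; rewrite /weight -sum1_card natr_sum; apply: eq_big => [s|s _].
  rewrite in_set; case: (aut G s) => //=; apply/commutesP => x.
  have fE y : f y = y by apply/eqP/negPn; rewrite -mem_moved f0 in_set0.
  by rewrite !fE.
by rewrite f0 orbit_sign0.
Qed.

(** As the terms outside [P] vanish, [f] ranges over all restrictions of [g]. Every automorphism
    commutes with [g], so after the exchange of sums [sum_orbit_sign_subfun] evaluates the sum for
    each [s]. *)
Lemma sum_weight_subfun G g (P : pred {ffun U -> U}) :
  (forall s, aut G s -> commutes s g) ->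
  (forall f, subfun f g -> ~~ P f -> weight G f = 0) ->
  \sum_(f | P f && subfun f g) weight G f = ((moved g == set0) * #|[set s | aut G
    s]|)%:R.
Proof.
move=> autg Pw.
have -> : \sum_(f | P f &&
  subfun f g) weight G f = \sum_(f | subfun f g) weight G f.
  rewrite [RHS](bigID P) /= [X in _ + X]big1 ?addr0;
    first by apply: eq_bigl => f; rewrite andbC.
  by move=> f /andP[fg /(Pw f fg)].
rewrite /weight (exchange_big_dep (aut G)) /=; last by move=> f s _ /andP[].
rewrite (eq_bigr (fun _ => (moved g == set0)%:R)) => [|s sG].
  rewrite (eq_bigl (mem [set s | aut G s])) => [|s]; last by rewrite /= in_set.
  by rewrite sumr_const natrM mulr_natr.
rewrite -(sum_orbit_sign_subfun (autg s sG)); apply: eq_bigl => f.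
by rewrite sG.
Qed.

(** Non-endpoints are fixed, so that the moved points are exactly the endpoints; the default of
    [odflt] is never reached, since an endpoint has a neighbor. *)
Definition pendant G : {ffun U -> U} :=
  [ffun u => if endpoint G u then odflt u [pick v in neighborhood G u] else u].

Lemma pendantP G u : endpoint G u -> neighborhood G u = [set pendant G u].
Proof.
move=> eu; rewrite ffunE eu; case/cards1P: eu => v ->.
by case: pickP => [w|/(_ v)]; rewrite !in_set1 => /eqP // ->.
Qed.

Lemma pendant_out G u : ~~ endpoint G u -> pendant G u = u.
Proof. by move=> eu; rewrite ffunE (negPf eu). Qed.

Lemma moved_pendant G : moved (pendant G) = [set u | endpoint G u].
Proof.
apply/setP => u; rewrite !in_set;
  have [eu|/pendant_out->] := boolP (endpoint G u); last by rewrite eqxx.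
apply/eqP => E; have : pendant G u \in neighborhood G u
  by rewrite pendantP // set11.
by rewrite in_set E [_ _ _]adj_irr.
Qed.

Lemma pendant_commutes G s : aut G s -> commutes s (pendant G).
Proof.
move=> sG; have bs : bijective s by exact: injF_bij perm_inj.
have nE u : neighborhood G (s u) = s @: neighborhood G u
  by exact: neighborhood_relabel.
apply/commutesP => u; have eE : endpoint G (s u) = endpoint G u.
  by rewrite /endpoint nE card_imset //; exact: perm_inj.
have [eu|eu] := boolP (endpoint G u); last by rewrite !pendant_out ?eE.
have := nE u; rewrite !pendantP ?eE // imset_set1 => /setP/(_ (s (pendant G u))).
by rewrite !in_set1 eqxx => /eqP.
Qed.

Lemma pendant_adj G u x : endpoint G u -> adj G u x = (x == pendant G u).
Proof. by move/pendantP/setP/(_ x); rewrite in_set1 in_set. Qed.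

(** The transposition is odd on [moved f], so [weight_odd] applies. It commutes with [f] because [f]
    agrees on its moved points with [pendant G], which commutes with every automorphism. *)
Lemma endpoint_twins_weight G f a b : subfun f (pendant G) ->
  a \in moved f -> b \in moved f -> a != b -> aut G (tperm a b) -> weight G f = 0.
Proof.
move=> fn aS bS ab tG.
have tf : tperm a b \in 'N(moved f | 'P)%g.
  apply/astabs_permP => x; case: tpermP => [->|->|//]; by rewrite aS bS.
apply: (weight_odd tG _ (odd_restr_tperm tf aS bS ab (fun x _ => erefl))).
apply/commutesP => x; have [fx|fx] := eqVneq (f x) x.
  rewrite fx; apply/esym/eqP/negPn; rewrite -mem_moved.
  by rewrite (astabs_permP _ _ tf) mem_moved fx eqxx.
have ftx : f (tperm a b x) != tperm a b x.
  by rewrite -mem_moved (astabs_permP _ _ tf) mem_moved.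
rewrite (subfunP _ _ fn _ ftx) (subfunP _ _ fn _ fx).
by apply/commutesP/pendant_commutes.
Qed.

Lemma sum_endpoint_weight G :
  \sum_(f | pairing f && subfun f (pendant G)) weight G f =
  (endpoint_free G * #|[set s | aut G s]|)%:R.
Proof.
rewrite (sum_weight_subfun (@pendant_commutes G)) => [|f fn].
  congr ((nat_of_bool _ * _)%:R); rewrite moved_pendant;
    apply/eqP/forallP => [E u|E].
    by have /setP/(_ u) := E; rewrite in_set in_set0 => ->.
  by apply/setP => u; rewrite in_set in_set0 (negPf (E u)).
have fE u : f u != u -> endpoint G u /\ f u = pendant G u.
  move=> fu; have E := subfunP _ _ fn _ fu; split=> //.
  have : u \in moved (pendant G) by rewrite mem_moved -E.
  by rewrite moved_pendant in_set.
rewrite negb_and => /orP[|].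
  (* Idempotence fails: [u] and [v] are two endpoints adjacent to each other, hence twins. *)
  case/forallPn => u; set v := f u => fv.
  have fu : f u != u by apply: contraNneq fv => E; rewrite /v !E.
  have [eu vE] := fE _ fu; have [ev fvE] := fE _ fv.
  have uv : pendant G v = u.
    by apply/esym/eqP; rewrite -pendant_adj // adj_sym pendant_adj // -vE.
  apply: (endpoint_twins_weight fn (a := u) (b := v));
    rewrite ?in_set // 1?eq_sym //.
  apply: twins_aut => x xu xv; rewrite !pendant_adj // uv -vE (negPf xu).
  by rewrite -/v (negPf xv).
(* Injectivity fails: [u] and [v] are two endpoints with the same neighbor. *)
case/forallPn => u /forallPn[v];
  rewrite negb_imply => /andP[/and3P[fu fv /eqP uv] neq].
have [eu uE] := fE _ fu; have [ev vE] := fE _ fv.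
apply: (endpoint_twins_weight fn (a := u) (b := v)); rewrite ?in_set //.
by apply: twins_aut => x _ _; rewrite !pendant_adj // -uE -vE uv.
Qed.

End Functions.

(** * Duplicate vertices and full extensions *)

Section Duplicates.
Variables (U : finType) (G : graph U).
Implicit Types (f g : {ffun U -> U}) (s t : {perm U}) (x y z : U).
Local Notation N := (neighborhood G).

Definition compat f : bool := [forall x, N (f x) == N x].
Definition thin f : bool :=
  [forall x, forall y, [&& f x != x, f y != y & N x == N y] ==> (x == y)].
Definition full f : bool :=
  [forall x, forall y, (x != y) && (N x == N y) ==>
    [exists z, (f z != z) && (N z == N x)]].
(** [thin] and [full] leave exactly one moved point in each class of at least two vertices with
    equal neighborhoods. Such a [g] takes the role that [pendant] has for endpoints, but it depends
    on choices. *)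
Definition full_extension f g : bool :=
  [&& pairing g, compat g, thin g, full g & subfun f g].

Lemma compatP f : reflect (forall x, N (f x) = N x) (compat f).
Proof. by apply: (iffP forallP) => h x; apply/eqP/h. Qed.

Lemma thinP f :
  reflect (forall x y, f x != x -> f y != y -> N x = N y -> x = y) (thin f).
Proof.
apply: (iffP forallP) => h x; last first.
  by apply/forallP => y; apply/implyP => /and3P[fx fy /eqP/h ->].
move=> y fx fy Nxy; apply/eqP; move: (h x) => /forallP/(_ y)/implyP; apply.
by rewrite fx fy Nxy eqxx.
Qed.

Lemma fullP f :
  reflect (forall x y, x != y -> N x = N y ->
    exists2 z, f z != z & N z = N x) (full f).
Proof.
apply: (iffP forallP) => h x; last first.
  apply/forallP => y; apply/implyP => /andP[xy /eqP /(h _ _ xy)[z fz Nz]].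
  by apply/existsP; exists z; rewrite fz Nz eqxx.
move=> y xy Nxy; move: (h x) => /forallP/(_ y)/implyP; rewrite xy Nxy eqxx.
by case/(_ isT)/existsP => z /andP[fz /eqP Nz]; exists z.
Qed.

Lemma same_adj x y z : N x = N y -> adj G x z = adj G y z.
Proof. by move/setP/(_ z); rewrite !in_set. Qed.

Lemma same_aut s : (forall x, N (s x) = N x) -> aut G s.
Proof.
by move=> h; apply/autP => x y;
  rewrite (same_adj _ (h x)) adj_sym (same_adj _ (h y)) adj_sym.
Qed.

Lemma tperm_same x y z : N x = N y -> N (tperm x y z) = N z.
Proof. by move=> xy; case: tpermP => [->|->|]. Qed.

(* If x and y are moved and have the same neighborhood, the exchange of the pairs
   (x, f x) and (y, f y) is an automorphism acting on the moved points as an odd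
   permutation. *)
Lemma nonthin_weight f : pairing f -> compat f -> ~~ thin f -> weight G f = 0.
Proof.
move=> /pairingP[ff finj] /compatP Nf.
case/forallPn => x /forallPn[y];
  rewrite negb_imply => /andP[/and3P[fx fy /eqP Nxy] xy].
have movf z : f z != z -> forall u, f u != z.
  by move=> fz u; apply: contraNneq fz => <-; rewrite ff.
pose t := (tperm x y * tperm (f x) (f y))%g.
have tE z : t z = tperm (f x) (f y) (tperm x y z) by rewrite permM.
have t_mov z : f z != z -> tperm (f x) (f y) z = z.
  by move=> fz; rewrite tpermD // movf.
have t_fix u : tperm x y (f u) = f u by rewrite tpermD // eq_sym movf.
have tf : commutes t f.
  apply/commutesP => z; rewrite !tE t_fix;
    case: (tpermP x y z) => [->|->|/eqP zx /eqP zy].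
  - by rewrite tpermL t_mov.
  - by rewrite tpermR t_mov.
  have [fz|fz] := eqVneq (f z) z.
    by rewrite fz; case: tpermP => [_|_|_ _]; rewrite ?ff ?fz.
  rewrite (t_mov _ fz) tpermD //.
    by apply: contraNneq zx => /esym /(finj _ _ fz fx) ->.
  by apply: contraNneq zy => /esym /(finj _ _ fz fy) ->.
apply: (@weight_odd _ _ _ t _ tf).
  apply: same_aut => z; rewrite tE !tperm_same // !Nf //.
apply: (odd_restr_tperm (commutes_stable tf) (a := x) (b := y));
  rewrite ?mem_moved //.
move=> z; rewrite mem_moved tE => fz; apply: t_mov.
by case: tpermP.
Qed.

Lemma pairing_thin g : (forall x, g (g x) = g x) -> compat g -> thin g -> pairing g.
Proof.
move=> gg /compatP Ng /thinP gt; apply/pairingP; split=> // x y gx gy gxy.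
by apply: gt => //; rewrite -Ng gxy Ng.
Qed.

Lemma full_extension_exists f :
  pairing f -> compat f -> thin f -> exists g, full_extension f g.
Proof.
move=> /pairingP[ff finj] /compatP Nf /thinP ft.
(* [g] keeps [f] on the classes where [f] moves a point ([E]), and elsewhere sends a representative
   [a] to a second member [b]. In a singleton class [b] defaults to [a], so nothing moves. *)
pose E u := [exists z, (f z != z) && (N z == N u)].
pose a u := odflt u [pick y | N y == N u].
pose b u := odflt (a u) [pick y | (N y == N u) && (y != a u)].
have Na u : N (a u) = N u by rewrite /a; case: pickP => [y /eqP|].
have Nb u : N (b u) = N u by rewrite /b; case: pickP => [y /andP[/eqP]|] //=;
  rewrite Na.
have aE u v : N u = N v -> a u = a v.
  move=> uv; rewrite /a uv; case: pickP => [//|/(_ v)]; by rewrite eqxx.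
have bE u v : N u = N v -> b u = b v by move=> uv; rewrite /b uv (aE u v).
have EE u v : N u = N v -> E u = E v by move=> uv; rewrite /E uv.
pose g : {ffun U -> U} :=
  [ffun u => if E u then f u else if u == a u then b u else u].
have Ng : compat g.
  by apply/compatP => u; rewrite ffunE; case: ifP => // _; case: ifP.
have gthin : thin g.
  apply/thinP => x y; rewrite !ffunE => + + xy; rewrite (EE _ _ xy);
    case: ifP => [_|_].
    by move=> fx fy; exact: ft.
  case: (x =P a x) => [xa|_]; last by rewrite eqxx.
  case: (y =P a y) => [ya|_]; last by rewrite eqxx.
  by rewrite xa [RHS]ya (aE _ _ xy).
exists g; rewrite /full_extension Ng gthin pairing_thin //=; last first.
  move=> u; rewrite [g u]ffunE; case: ifP => [Eu|Eu].
    by rewrite ffunE (EE _ _ (Nf u)) Eu ff.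
  case: eqP => [_|/eqP/negPf ua]; rewrite ffunE ?Eu ?ua //.
  rewrite (EE _ _ (Nb u)) Eu (aE _ _ (Nb u)) (bE _ _ (Nb u)).
  by case: ifP.
apply/andP; split; last first.
  apply/subfunP => x fx; rewrite ffunE ifT //.
  by apply/existsP; exists x; rewrite fx eqxx.
apply/fullP => x y xy Nxy; have [Ex|Ex] := boolP (E x).
  case/existsP: (Ex) => z /andP[fz /eqP Nz]; exists z => //.
  by rewrite ffunE (EE _ _ Nz) Ex.
exists (a x); rewrite ?Na // ffunE (EE _ _ (Na x)) (negPf Ex) (aE _ _ (Na x)) eqxx.
rewrite (bE _ _ (Na x)) /b; case: pickP => [z /andP[]//|none].
have := none x; have := none y;
  rewrite Nxy eqxx /= => /negbFE/eqP yE /negbFE/eqP xE.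
by case/eqP: xy; rewrite xE -yE.
Qed.

(** [k] is built class by class: [p u] carries the moved point of [g0] and its image to those of
    [g]. Since [p u] depends only on the class of [u] and preserves it, sending [u] to [p u u] is
    injective. *)
Lemma full_extension_transport f g0 g :
  compat f -> full_extension f g0 -> full_extension f g -> exists k : {perm U},
  [/\ aut G k, commutes k f, forall x, k (g0 x) = g (k x) & {in moved f, k =1 id}].
Proof.
move=> /compatP Nf /and5P[_ /compatP N0 t0 full0 /subfunP sub0].
move=> /and5P[_ /compatP N1 t1 full1 /subfunP sub1].
(* The moved point of [h] in the class of [u]; for a full [h] the default occurs only in singleton
   classes. *)
pose sel (h : {ffun U -> U}) u := odflt u [pick z | (h z != z) && (N z == N u)].
have selN h u : N (sel h u) = N u by rewrite /sel;
  case: pickP => [z /andP[_ /eqP]|].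
have sel_mov (h : {ffun U -> U}) u : thin h -> h u != u -> sel h u = u.
  move=> /thinP th hu; rewrite /sel; case: pickP => [z /andP[hz /eqP Nz]|/(_ u)] /=.
    exact: th.
  by rewrite hu eqxx.
have selE h u v : full h -> N u = N v -> sel h u = sel h v.
  move=> /fullP fullh uv; rewrite /sel uv; case: pickP => [//|none] /=.
  have [//|uv'] := eqVneq u v; have [z hz Nz] := fullh _ _ uv' uv.
  by have := none z; rewrite hz Nz uv eqxx.

have sel_fix (h : {ffun U -> U}) u : thin h -> full h -> h (sel h u) = sel h u ->
    forall v, N v = N u -> v = u.
  move=> th fh hs v vu; apply/eqP; apply/negPn/negP => vu'.
  have [z hz Nz] := elimT (fullP _) fh _ _ vu' vu.
  have zE : z = sel h u by rewrite -(selE h z u fh) ?sel_mov // Nz.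
  by rewrite zE hs eqxx in hz.
(* The first transposition may displace [g0 (sel g0 u)], so the second starts from its image under
   [a]. *)
pose p u := let a := tperm (sel g0 u) (sel g u) in
  (a * tperm (a (g0 (sel g0 u))) (g (sel g u)))%g.
have Np u z : N z = N u -> N (p u z) = N u.
  by move=> zu; rewrite permM !tperm_same ?N0 ?N1 ?selN.
have pE u v : N u = N v -> p u = p v.
  by move=> uv; rewrite /p (selE g0 u v) // (selE g u v).
have k_inj : injective (fun u => p u u).
  move=> u v E; have uv : N u = N v by rewrite -(Np u u) // E Np.
  by apply: (@perm_inj _ (p v)); rewrite -{1}(pE _ _ uv).
pose k := perm k_inj.
have kE u : k u = p u u by rewrite permE.
have Nk u : N (k u) = N u by rewrite kE Np.
have p_sel u : g0 (sel g0 u) != sel g0 u -> g (sel g u) != sel g u ->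
    p u (sel g0 u) = sel g u /\ p u (g0 (sel g0 u)) = g (sel g u).
  move=> h0 h1; rewrite !permM tpermL; split; last by rewrite tpermL.
  rewrite tpermD //; rewrite -{2}(tpermL (sel g0 u) (sel g u)) (inj_eq perm_inj) //.
have cls u : (forall v, N v = N u -> v = u) \/
    g0 (sel g0 u) != sel g0 u /\ g (sel g u) != sel g u.
  have [h0|h0] := eqVneq (g0 (sel g0 u)) (sel g0 u).
    by left; exact: (sel_fix g0).
  have [h1|h1] := eqVneq (g (sel g u)) (sel g u); last by right.
  by left; exact: (sel_fix g).
(* Where [f] moves [x], both extensions select [x] and send it to [f x], so [p x] is the
   identity. *)
have kid x : f x != x -> k x = x /\ k (f x) = f x.
  move=> fx; have [E0 E1] := (sub0 _ fx, sub1 _ fx).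
  have s0 : sel g0 x = x by rewrite sel_mov // -E0.
  have s1 : sel g x = x by rewrite sel_mov // -E1.
  have p1 : p x = 1%g by rewrite /p s0 s1 -E0 -E1 /= tperm1 perm1 tperm1 mulg1.
  by rewrite !kE (pE (f x) x) // p1 !perm1.
exists k; split.
- exact: same_aut.
- apply/commutesP => x; have [fx|fx] := eqVneq (f x) x; last first.
    by have [-> ->] := kid _ fx.
  rewrite fx; apply/esym/eqP/negPn/negP => fk; have [kk _] := kid _ fk.
  by case/eqP: fk; rewrite (perm_inj kk).
- move=> x; have [triv|[h0 h1]] := cls x.
    by rewrite (triv (g0 x)) ?N0 // (triv (k x)) ?Nk // (triv (g x)) ?N1.
  have [pa pb] := p_sel x h0 h1; have [gx|gx] := eqVneq (g0 x) x; last first.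
    rewrite !kE (pE (g0 x) x) //.
    by move: pa pb; rewrite (sel_mov g0 x) // => -> ->.
  (* If [g] moved [k x], then [k x] would be the selected point of [g], which [p x] reaches from
     [sel g0 x]; so [x] would be moved by [g0]. *)
  rewrite gx; apply/esym/eqP/negPn/negP => gk.
  have : p x x = p x (sel g0 x).
    by rewrite pa -kE -(sel_mov g (k x)) //; apply: selE.
  by move/perm_inj => xE; rewrite -xE gx eqxx in h0.
by move=> x; rewrite mem_moved => /kid[].
Qed.

(* The automorphisms commuting with f act on the full extensions of f, and by
   [full_extension_transport] those fixing all moved points of f are already
   transitive: hence the automorphisms mapping a given full extension to g have
   the same signed count as those fixing g. *)
Lemma weight_full_extension f : pairing f -> compat f -> thin f ->
  weight G f = \sum_(g | full_extension f g)
    \sum_(s | [&& aut G s, commutes s f & commutes s g]) orbit_sign s (moved f).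
Proof.
move=> gf cf tf; have [g0 eg0] := full_extension_exists gf cf tf.
(* The conjugate of [g0] by [s]; the automorphisms are grouped by it. *)
pose cj s : {ffun U -> U} := [ffun x => s (g0 ((s^-1)%g x))].
have cjE s x : cj s (s x) = s (g0 x) by rewrite ffunE permK.
rewrite /weight (partition_big cj (full_extension f)) => [|s /andP[sG sf]];
  last first.
  have Ns x y : (N (s x) == N (s y)) = (N x == N y).
    have bs : bijective s by exact: injF_bij perm_inj.
    rewrite !(neighborhood_relabel _ bs sG) (inj_eq (imset_inj _)) //;
      exact: perm_inj.
  have NsP x y : N (s x) = N (s y) <-> N x = N y.
    by split => /eqP; rewrite ?Ns => /eqP // ?; apply/eqP; rewrite Ns; apply/eqP.
  have surj x : exists y, x = s y by exists ((s^-1)%g x); rewrite permKV.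
  have/and5P[_ /compatP N0 /thinP t0 /fullP full0 /subfunP sub0] := eg0.
  have cc : compat (cj s).
    by apply/compatP => x; have [y ->] := surj x; rewrite cjE; apply/NsP.
  have ct : thin (cj s).
    apply/thinP => x y; have [x' ->] := surj x; have [y' ->] := surj y.
    by rewrite !cjE !(inj_eq perm_inj) => hx hy /NsP E; rewrite (t0 x' y').
  apply/and5P; split => //.
  - apply: pairing_thin => // x; have [x' ->] := surj x; rewrite !cjE.
    by have/and5P[/pairingP[->]] := eg0.
  - apply/fullP => x y; have [x' ->] := surj x; have [y' ->] := surj y.
    rewrite (inj_eq perm_inj) => xy /NsP E; have [z hz Nz] := full0 _ _ xy E.
    by exists (s z); rewrite ?cjE ?(inj_eq perm_inj) //; apply/NsP.
  apply/subfunP => x; have [x' ->] := surj x.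
  by rewrite cjE -(elimT (commutesP _ _) sf) (inj_eq perm_inj) => /sub0 ->.
apply: eq_bigr => g eg;
  have [k [kG kf kg kid]] := full_extension_transport cf eg0 eg.
(* As [k] carries [g0] to [g], composing with it turns the condition on [cj] into commutation with
   [g]; the sign is unchanged because [k] fixes the moved points of [f]. *)
rewrite (reindex_inj (mulgI k)) /=; apply: eq_big => s.
  rewrite autM // commutesM // -andbA; congr [&& _, _ & _].
  apply/eqP/commutesP => [E x|h].
    by have := cjE (k * s)%g ((k^-1)%g x); rewrite E !permM kg permKV => ->.
  apply/ffunP => x; have := cjE (k * s)%g (((k * s)^-1)%g x).
  by rewrite permKV => ->; rewrite permM kg h -permM permKV.
rewrite autM // commutesM // => /andP[/andP[_ sf] _].
rewrite orbit_signM ?commutes_stable //.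
rewrite (_ : restr_perm (moved f) k = 1%g) ?odd_perm1 ?mul1r //.
apply/permP => x; rewrite perm1; have [xf|xf] := boolP (x \in moved f).
  by rewrite restr_perm_in ?commutes_stable // kid.
by rewrite restr_perm_out.
Qed.

(* After the exchange of sums, f ranges over all the restrictions of a fixed g,
   so that [sum_orbit_sign_subfun] applies. *)
Lemma sum_duplicate_weight :
  \sum_(f | pairing f && compat f) weight G f =
  (point_determining G * #|[set s | aut G s]|)%:R.
Proof.
have [pd|npd] := boolP (point_determining G).
  have inj x y : N x = N y -> x = y.
    move=> Nxy; apply/eqP; have /forallP/(_ x)/forallP/(_ y) := pd.
    by rewrite /duplicates Nxy eqxx andbT negbK.
  (* Without duplicates the identity is the only compatible map. *)
  rewrite (big_pred1 [ffun x => x]) => [|f] /=.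
    rewrite mul1n weight_id //; apply/setP => x.
    by rewrite mem_moved ffunE eqxx in_set0.
  apply/andP/eqP => [[_ /compatP Nf]|->].
    by apply/ffunP => x; rewrite ffunE; apply: inj.
  split; last by apply/compatP => x; rewrite ffunE.
  by apply/pairingP; split=> [x|x y]; rewrite !ffunE // eqxx.
rewrite mul0n (bigID thin) /= [X in _ + X]big1 ?addr0; last first.
  by move=> f /andP[/andP[gf cf]]; exact: nonthin_weight.
pose Q g := [&& pairing g, compat g, thin g & full g].
(* Every restriction of such a [g] is again a thin compatible pairing, so in the exchanged sum [f]
   is constrained only by [subfun] and by commuting with [s]. *)
have subQ f g : Q g -> subfun f g -> pairing f && compat f && thin f.
  case/and4P => /pairingP[gg ginj] /compatP Ng /thinP tg _ /subfunP fg.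
  have mg x : f x != x -> g x != x by move=> fx; rewrite -fg.
  have Nf : compat f.
    by apply/compatP => x; have [->//|/fg ->] := eqVneq (f x) x.
  have tf : thin f by apply/thinP => x y /mg gx /mg gy; exact: tg.
  rewrite Nf tf pairing_thin // => x; have [E|fx] := eqVneq (f x) x;
    first by rewrite !E.
  have [//|ffx] := eqVneq (f (f x)) (f x).
  by rewrite (fg _ ffx) (fg _ fx) gg.
have -> : \sum_(f | pairing f && compat f && thin f) weight G f =
    \sum_(f | pairing f && compat f && thin f) \sum_(g | full_extension f g)
      \sum_(s | [&& aut G s, commutes s f & commutes s g]) orbit_sign s (moved f).
  by apply: eq_bigr => f /andP[/andP[gf cf] tf]; exact: weight_full_extension.
rewrite (exchange_big_dep Q) /=; last by move=> f g _ /and5P[*]; apply/and4P.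
apply: big1 => g Qg.
rewrite (exchange_big_dep (fun s => aut G s && commutes s g)) /=; last first.
  by move=> f s _ /and3P[-> _ ->].
apply: big1 => s /andP[sG sg].
have full_g : full g by case/and4P: Qg.
(* [G] has duplicates, so fullness makes [g] move a point and the signed sum vanishes. *)
have g0 : moved g == set0 = false.
  case/forallPn: npd => x /forallPn[y]; rewrite negbK => /andP[xy /eqP Nxy].
  have [z gz _] := elimT (fullP _) full_g _ _ xy Nxy.
  by apply/negP => /eqP/setP/(_ z); rewrite mem_moved gz in_set0.
transitivity ((moved g == set0)%:R : int); last by rewrite g0.
rewrite -(sum_orbit_sign_subfun sg); apply: eq_bigl => f.
rewrite sG sg andbT; case: (commutes s f); rewrite ?andbF // !andbT.
apply/andP/idP => [[_ /and5P[]]//|fg]; have fP := subQ f g Qg fg.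
by split=> //; case/and4P: Qg => *; apply/and5P.
Qed.
End Duplicates.

(** * Pullbacks of graphs and the counting of isomorphism classes *)

Lemma graphP (U : finType) (G H : graph U) : adj G =2 adj H -> G = H.
Proof. by move=> h; apply/val_inj/setP => -[x y]; exact: h. Qed.

Lemma pull_simple (U V : finType) (f : V -> U) (G : graph U) :
  simple_edges [set p : V * V | adj G (f p.1) (f p.2)].
Proof.
apply/andP; split; apply/forallP => x; first by rewrite in_set /= adj_irr.
by apply/forallP => y; rewrite !in_set /= adj_sym.
Qed.

(** With the inverse of a permutation this is relabeling; with a pairing [f] it makes each moved [x]
    a duplicate of [f x]. *)
Definition pull (U V : finType) (f : V -> U) (G : graph U) : graph V :=
  Graph (pull_simple f G).

Lemma pullE (U V : finType) (f : V -> U) (G : graph U) x y :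
  adj (pull f G) x y = adj G (f x) (f y).
Proof. by rewrite /adj /= in_set. Qed.

Section Burnside.
Variable U : finType.
Implicit Types (G : graph U) (s t : {perm U}).

Definition relabel G s : graph U := pull (s^-1)%g G.

Lemma relabel1 G : relabel G 1%g = G.
Proof. by apply: graphP => x y; rewrite pullE invg1 !perm1. Qed.

Lemma relabelM G s t : relabel G (s * t)%g = relabel (relabel G s) t.
Proof. by apply: graphP => x y; rewrite !pullE invMg !permM. Qed.

Canonical relabel_action := TotalAction relabel1 relabelM.

Lemma relabelP G H s : reflect (relabel G s = H) (is_relabeling s G H).
Proof.
apply: (iffP forallP) => [h|<- x]; last by apply/forallP => y; rewrite pullE !permK.
apply: graphP => x y; rewrite pullE.
by have /forallP/(_ ((s^-1)%g y))/eqP := h ((s^-1)%g x); rewrite !permKV.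
Qed.

(** Isomorphism classes are the orbits of relabeling, and [s] fixes the graphs having it as an
    automorphism; exchanging sums in the Cauchy-Frobenius count gives a sum over graphs. *)
Lemma burnside (F : graph_species) :
  (#|equivalence_partition (@isomorphic U) (F U)| * #|U|`!)%N =
  (\sum_(G in F U) #|[set s | aut G s]|)%N.
Proof.
have actF : [acts [set: {perm U}], on F U | relabel_action].
  apply/subsetP => s _; apply/astabsP => G /=; apply/esym.
  apply: (structuresP F (injF_bij (@perm_inj _ s))).
  by apply/relabelP.
have -> : equivalence_partition (@isomorphic U) (F U) =
    orbit relabel_action [set: {perm U}] @: F U.
  apply: eq_in_imset => G GF; apply/setP => H; rewrite in_set; apply/andP/orbitP.
    by move=> [_ /existsP[s /relabelP sG]]; exists s.
  move=> [s _ <-]; split; last by apply/existsP; exists s; apply/relabelP.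
  by rewrite (acts_act actF) ?in_setT.
have := Frobenius_Cauchy actF.
have -> : #|[set: {perm U}]| = #|U|`!.
  rewrite -[in RHS]cardsT -card_perm; apply: eq_card => s; rewrite in_setT.
  by apply/esym/subsetP => x; rewrite in_setT.
move=> <-.
transitivity (\sum_(s : {perm U}) \sum_(G in F U) aut G s)%N.
  apply: eq_big => s; first by rewrite in_setT.
  move=> _; rewrite -sum1_card big_mkcond [RHS]big_mkcond; apply: eq_bigr => G _.
  rewrite in_setI; case: (G \in F U) => //=.
  by have -> : (G \in 'Fix_relabel_action[s]%g) = aut G s by apply/afix1P/relabelP.
rewrite exchange_big; apply: eq_bigr => G _.
by rewrite -sum1_card [RHS]big_mkcond; apply: eq_bigr => s _; rewrite in_set.
Qed.

End Burnside.

(** * Turning endpoints into duplicates and back *)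

Section Transfer.
Variable U : finType.
Implicit Types (f : {ffun U -> U}) (G H : graph U).

(** For a pairing [f], the old edges at moved points are discarded and each moved [x] is joined to
    [f x] alone; [p.1 != p.2] prevents loops at fixed points. *)
Lemma attach_simple f G : simple_edges [set p |
  [&& f p.1 == p.1, f p.2 == p.2 & adj G p.1 p.2] ||
  (p.1 != p.2) && ((f p.1 == p.2) || (f p.2 == p.1))].
Proof.
apply/andP; split; apply/forallP => x;
  first by rewrite in_set /= adj_irr eqxx !andbF.
apply/forallP => y; rewrite !in_set /= adj_sym [y == x]eq_sym [(f y == x) || _]orbC.
by rewrite andbCA.
Qed.

Definition attach f G : graph U := Graph (attach_simple f G).

Lemma attachE f G x y : adj (attach f G) x y =
  [&& f x == x, f y == y & adj G x y] || (x != y) && ((f x == y) || (f y == x)).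
Proof. by rewrite {1}/adj /= in_set. Qed.

Lemma attach_moved f G x y :
  pairing f -> f x != x -> adj (attach f G) x y = (y == f x).
Proof.
move=> /pairingP[ff _] fx; rewrite attachE (negPf fx) /= eq_sym.
have [->|yfx] := eqVneq y (f x); first by rewrite fx.
have -> : (f y == x) = false by apply/eqP => yx; move: fx; rewrite -yx ff eqxx.
by rewrite orbF andbF.
Qed.

Lemma subfun_attach f G : pairing f -> subfun f (pendant (attach f G)).
Proof.
move=> gf; apply/subfunP => x fx; have nE : neighborhood (attach f G) x = [set f x].
  by apply/setP => y; rewrite in_set in_set1 attach_moved.
have ex : endpoint (attach f G) x by rewrite /endpoint nE cards1.
by apply/esym/eqP; rewrite -in_set1 -nE pendantP // set11.
Qed.

Lemma compat_pull f G : pairing f -> compat (pull f G) f.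
Proof.
by move=> /pairingP[ff _]; apply/compatP => x; apply/setP => y;
  rewrite !in_set !pullE ff.
Qed.

Lemma subfun_pendant_adj f G x y :
  subfun f (pendant G) -> f x != x -> adj G x y = (y == f x).
Proof.
move=> /subfunP fn fx; rewrite (fn _ fx) pendant_adj //.
have : x \in moved (pendant G) by rewrite mem_moved -fn.
by rewrite moved_pendant in_set.
Qed.

(** Only edges at moved points are altered, and they can be restored: in [G] a moved [x] is an
    endpoint attached to [f x]. In [attachK] it is compatibility that restores them, from the edges
    at [f x]. *)
Lemma pullK f G : pairing f -> subfun f (pendant G) -> attach f (pull f G) = G.
Proof.
move=> gf fn; apply: graphP => x y; have [fx|fx] := eqVneq (f x) x; last first.
  by rewrite attach_moved // (subfun_pendant_adj y fn).
have [fy|fy] := eqVneq (f y) y; last first.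
  by rewrite adj_sym attach_moved // adj_sym (subfun_pendant_adj x fn).
rewrite attachE pullE fx fy !eqxx /= [y == x]eq_sym orbb.
by rewrite andNb orbF.
Qed.

Lemma attachK f G : pairing f -> compat G f -> pull f (attach f G) = G.
Proof.
move=> /pairingP[ff _] /compatP Nf; apply: graphP => x y;
  rewrite pullE attachE !ff !eqxx.
rewrite [f y == f x]eq_sym orbb andNb orbF /=.
by rewrite (same_adj _ (Nf x)) adj_sym (same_adj _ (Nf y)) adj_sym.
Qed.

Lemma aut_pull f G s : commutes s f -> aut G s -> aut (pull f G) s.
Proof.
by move=> /commutesP sf /autP sG; apply/autP => x y; rewrite !pullE -!sf sG.
Qed.

Lemma aut_attach f G s : commutes s f -> aut G s -> aut (attach f G) s.
Proof.
move=> /commutesP sf /autP sG; apply/autP => x y.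
by rewrite !attachE -!sf !(inj_eq perm_inj) sG.
Qed.

Lemma weight_pull f G :
  pairing f -> subfun f (pendant G) -> weight (pull f G) f = weight G f.
Proof.
move=> gf fn; apply: eq_bigl => s; have [sf|] := boolP (commutes s f);
  last by rewrite !andbF.
rewrite !andbT; apply/idP/idP => [/(aut_attach sf)|]; last exact: aut_pull.
by rewrite pullK.
Qed.

Variable Phi : graph_species.
Hypothesis Phi_endpoints : closed_under_endpoints Phi.
Hypothesis Phi_ge2_duplicates : closed_under_duplicates (species_ge2 Phi).
Hypothesis U_ge3 : (2 < #|U|)%N.

(** Deleting the endpoint [x] from [G] and deleting the duplicate [x] from the pullback leave the
    same graph. It has at least two vertices as [U] has at least three, so the closure of the
    species [species_ge2 Phi] applies. *)
Lemma mem_pull1 G x y : neighborhood G x = [set y] ->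
  (pull (fun z => if z == x then y else z) G \in Phi U) = (G \in Phi U).
Proof.
move=> Nx; set r := fun z => _; set H := pull r G.
have xy : x != y.
  apply/eqP => xy; have : y \in neighborhood G x by rewrite Nx set11.
  by rewrite in_set -xy [adj _ _ _]adj_irr.
have ex : endpoint G x by rewrite /endpoint Nx cards1.
have dup : duplicates H x y.
  rewrite /duplicates xy; apply/eqP/setP => z; rewrite !in_set !pullE /r eqxx.
  by rewrite [y == x]eq_sym (negPf xy).
have dE : del_vertex H x = del_vertex G x.
  apply: graphP => u v; rewrite /adj /= !in_set /= pullE /r.
  by rewrite (negPf (valP u)) (negPf (valP v)).
have cardD : (1 < #|{: {z : U | z != x}}|)%N.
  by have -> : #|{: {z : U | z != x}}| = #|U|.-1;
    [rewrite card_sig -(cardC1 x) | lia].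
have := Phi_ge2_duplicates dup; have := Phi_endpoints ex; rewrite dE !in_set cardD.
rewrite (ltnW U_ge3) !andbT => h1 h2.
by apply/idP/idP; [move/h2/h1 | move/h1/h2].
Qed.

Lemma mem_pull f G : pairing f -> subfun f (pendant G) ->
  (pull f G \in Phi U) = (G \in Phi U).
Proof.
move=> gf fn; have /pairingP[ff finj] := gf.
(* Only the endpoints in [A] are turned into duplicates; induction on the size of [A] adds them one
   at a time. *)
pose h (A : {set U}) x := if x \in A then f x else x.
have hE : pull (h (moved f)) G = pull f G.
  by apply: graphP => x y; rewrite !pullE /h !mem_moved;
    do 2![case: eqP => [->|_] /=].
suff memA n (A : {set U}) : #|A| = n -> A \subset moved f ->
    (pull (h A) G \in Phi U) = (G \in Phi U) by rewrite -hE (memA _ _ erefl).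
elim: n A => [|n IH] A.
  move/cards0_eq => -> _; suff -> : pull (h set0) G = G by [].
  by apply: graphP => x y; rewrite pullE /h !in_set0.
move=> cA; have [x xA] : exists x, x \in A by apply/set0Pn; rewrite -card_gt0 cA.
move=> Af; have fx : f x != x by rewrite -mem_moved (subsetP Af).
have Bf : A :\ x \subset moved f by apply: subset_trans Af; apply: subsetDl.
rewrite -(IH (A :\ x) _ Bf); last by have := cardsD1 x A; rewrite xA cA; lia.
(* [x] is still an endpoint: another neighbor would be a converted [y] with [f y = f x], excluded by
   injectivity on moved points. *)
have Nx : neighborhood (pull (h (A :\ x)) G) x = [set f x].
  apply/setP => y; rewrite in_set in_set1 [adj _ _ _]pullE {1}/h in_setD1 eqxx /=.
  rewrite (subfun_pendant_adj _ fn fx) /h; case: ifP => //;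
    rewrite in_setD1 => /andP[yx yA].
  have fy : f y != y by rewrite -mem_moved (subsetP Af).
  have -> : (y == f x) = false by apply/negP => /eqP yE; rewrite yE ff eqxx in fy.
  by apply/negP => /eqP /(finj _ _ fy fx) yx'; rewrite yx' eqxx in yx.
rewrite -(mem_pull1 Nx).
have hx z : h (A :\ x) (if z == x then f x else z) = h A z.
  rewrite /h; case: (z =P x) => [->|/eqP zx]; last by rewrite in_setD1 zx.
  by rewrite xA ff if_same.
set H := (X in _ = (X \in _)); suff -> : pull (h A) G = H by [].
by apply: graphP => u v; rewrite !pullE !hx.
Qed.

Lemma sum_endpoint_duplicate f : pairing f ->
  \sum_(G in Phi U | subfun f (pendant G)) weight G f =
  \sum_(G in Phi U | compat G f) weight G f.
Proof.
move=> gf; rewrite [RHS](reindex_onto (pull f) (attach f)) => [|G /andP[_]];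
  last exact: attachK.
apply: eq_big => [G|G /andP[_ fn]]; last by rewrite weight_pull.
apply/andP/andP => [[GP fn]|[/andP[GP _] /eqP <-]]; last first.
  by rewrite -(mem_pull gf (subfun_attach (pull f G) gf)) attachK ?compat_pull
    ?subfun_attach.
by rewrite mem_pull // GP compat_pull // pullK.
Qed.

Lemma sum_card_aut_point_determining :
  (\sum_(G in species_point_determining Phi U) #|[set s | aut G s]| =
   \sum_(G in species_endpoint_free Phi U) #|[set s | aut G s]|)%N.
Proof.
have cond (P : pred (graph U)) (F : {set graph U}) :
    F = [set G in Phi U | P G] -> (\sum_(G in F) #|[set s | aut G s]| =
    \sum_(G in Phi U) P G * #|[set s | aut G s]|)%N.
  move=> ->; rewrite big_mkcond [RHS]big_mkcond; apply: eq_bigr => G _.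
  by rewrite in_set; case: (G \in Phi U); case: (P G); rewrite ?mul1n.
rewrite (cond (@point_determining U)) // (cond (@endpoint_free U)) //.
(* The weights are signed, so the equality is moved to the integers. *)
apply/eqP; rewrite -(Num.Theory.eqr_nat int) !natr_sum; apply/eqP.
under eq_bigr do rewrite -sum_duplicate_weight.
under [RHS]eq_bigr do rewrite -sum_endpoint_weight.
rewrite (exchange_big_dep (@pairing U)) /=; last by move=> G f _ /andP[].
rewrite [RHS](exchange_big_dep (@pairing U)) /=; last by move=> G f _ /andP[].
apply: eq_bigr => f gf; rewrite gf.
by rewrite sum_endpoint_duplicate.
Qed.
End Transfer.

(** * Coefficients of the series, orders at most 2, and conclusion *)

Lemma type_series_fact (F : graph_species) n :
  (type_series F n * n`!)%N = (\sum_(G in F 'I_n) #|[set s | aut G s]|)%N.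
Proof. by rewrite -burnside card_ord. Qed.

Lemma type_series1 (F : graph_species) n (G : graph 'I_n) :
  F 'I_n = [set G] -> type_series F n = 1%N.
Proof. by rewrite /type_series /equivalence_partition => ->;
  rewrite imset_set1 cards1. Qed.

Lemma type_series0 (F : graph_species) n : F 'I_n = set0 -> type_series F n = 0%N.
Proof. by rewrite /type_series /equivalence_partition => ->;
  rewrite imset0 cards0. Qed.

Section SmallOrder.
Variable Phi : graph_species.
Hypothesis Phi_connected : species_of_connected_graphs Phi.
Hypothesis Phi_one_vertex : contains_one_vertex_graph Phi.
Hypothesis Phi_endpoints : closed_under_endpoints Phi.

Lemma K2_simple : simple_edges [set p : 'I_2 * 'I_2 | p.1 != p.2].
Proof.
apply/andP; split; apply/forallP => x; first by rewrite in_set /= eqxx.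
by apply/forallP => y; rewrite !in_set /= [y == x]eq_sym.
Qed.

Definition K2 : graph 'I_2 := Graph K2_simple.

Lemma K2E x y : adj K2 x y = (x != y).
Proof. by rewrite /adj /= in_set. Qed.

Lemma neighborhood_K2 x : exists2 y, x != y & neighborhood K2 x = [set y].
Proof.
have E : neighborhood K2 x = ~: [set x].
  by apply/setP => z; rewrite in_setC in_set1 in_set [LHS]K2E eq_sym.
have /eqP/cards1P[y yE] : #|neighborhood K2 x| = 1%N.
  by have := cardsC [set x]; rewrite E cards1 card_ord; lia.
by exists y => //; have := set11 y; rewrite -yE E in_setC in_set1 eq_sym.
Qed.

Lemma endpoint_K2 x : endpoint K2 x.
Proof. by have [y _ E] := neighborhood_K2 x; rewrite /endpoint E cards1. Qed.

(** Connectedness leaves only [K2], which belongs to [Phi] since deleting an endpoint yields the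
    one-vertex graph. *)
Lemma Phi2 : Phi 'I_2 = [set K2].
Proof.
apply/setP => G; rewrite in_set1; apply/idP/eqP => [GP|->].
  have /andP[_ /forallP conn] := Phi_connected GP.
  (* With only two vertices, the first step of a path from [x] already reaches [y]. *)
  have adj01 x y : x != y -> adj G x y.
    move=> xy; have /forallP/(_ y)/connectP[[|z p] /= pth yE] := conn x.
      by rewrite yE eqxx in xy.
    have /andP[xz _] := pth; suff -> : y = z by [].
    have zx : z != x by apply: contraTneq xz => ->; rewrite adj_irr.
    by apply: val_inj; move: xy zx (ltn_ord x) (ltn_ord y) (ltn_ord z);
       rewrite -!val_eqE /=; lia.
  apply: graphP => x y; rewrite K2E; have [->|] := eqVneq x y;
    first by rewrite adj_irr.
  by move/adj01 => ->.
apply/(Phi_endpoints (endpoint_K2 ord0)); apply: Phi_one_vertex.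
by rewrite card_sig (cardC1 (ord0 : 'I_2)) card_ord.
Qed.

End SmallOrder.

Theorem theorem5p19 (Phi : graph_species)
    (Phi_connected : species_of_connected_graphs Phi)
    (Phi_one_vertex : contains_one_vertex_graph Phi)
    (Phi_endpoints : closed_under_endpoints Phi)
    (Phi_ge2_duplicates : closed_under_duplicates (species_ge2 Phi)) :
  type_series (species_point_determining Phi) =1
  fps_add (type_series (species_endpoint_free Phi)) (fps_Xn 2).
Proof.
move=> n; rewrite /fps_add /fps_Xn.
have [n3|] := ltnP 2 n.
  have -> : (n == 2) = false by lia.
  rewrite addn0; apply/eqP; rewrite -(eqn_pmul2r (fact_gt0 n)) !type_series_fact.
  by rewrite (sum_card_aut_point_determining Phi_endpoints) ?card_ord.
case: n => [|[|[|//]]] _.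
- have P0 : Phi 'I_0 = set0.
    apply/setP => G; rewrite in_set0; apply/negP => /Phi_connected/andP[].
    by rewrite card_ord.
  by rewrite !type_series0 //; apply/setP => G; rewrite in_set P0 !in_set0.
(* On one vertex there is no edge, and both conditions hold. *)
- rewrite addn0; congr #|equivalence_partition _ _|; apply/setP => G;
  rewrite !in_set.
  congr (_ && _); have G0 x y : adj G x y = false
    by rewrite [x]ord1 [y]ord1 adj_irr.
  apply/forallP/forallP => _ x.
    rewrite /endpoint (_ : neighborhood G x = set0) ?cards0 //.
    by apply/setP => y; rewrite in_set in_set0; exact: G0.
  by apply/forallP => y; rewrite /duplicates [x]ord1 [y]ord1 eqxx.
(* On two vertices [K2] is point-determining but has endpoints, which accounts for the term x^2. *)
have P2 := Phi2 Phi_connected Phi_one_vertex Phi_endpoints.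
rewrite (@type_series1 _ _ K2) ?type_series0 //; apply/setP => G;
  rewrite in_set P2 ?in_set0 !in_set1.
  by case: eqP => // ->; apply/forallP => /(_ ord0); rewrite endpoint_K2.
apply: andb_idr => /eqP ->; apply/forallP => x; apply/forallP => y.
have [x' xx' Nx] := neighborhood_K2 x; have [y' yy' Ny] := neighborhood_K2 y.
rewrite /duplicates Nx Ny (inj_eq set1_inj).
move: xx' yy' (ltn_ord x) (ltn_ord y) (ltn_ord x') (ltn_ord y').
by rewrite -!val_eqE /=; lia.
Qed.
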